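(* Let $c$ be a prime power, i.e. $c = p^n$ with $p$ prime and $n \ge 1$ an integer. If $(a,b,c)$ and $(a',b',c)$ are triples of positive integers with $a \le b \le c$, $a' \le b' \le c$, and $$a^2+b^2+c^2 = 3abc, \qquad a'^2+b'^2+c^2 = 3a'b'c,$$ then $a = a'$ and $b = b'$.
   Context: A Markoff triple is a triple $(a,b,c)$ of positive integers satisfying the Markoff equation $a^2+b^2+c^2=3abc$; the integers appearing in Markoff triples are called Markoff numbers. The Markoff conjecture states that a Markoff triple $(a,b,c)$ ordered so that $a\le b\le c$ is uniquely determined by $c$. The theorem asserts that this holds whenever $c$ is a prime power. *)

(* Defs.v *)
From mathcomp Require Import all_boot.

Definition markoff_triple (a b c : nat) : Prop :=
  [/\ 0 < a, 0 < b, 0 < c & a ^ 2 + b ^ 2 + c ^ 2 = 3 * a * b * c].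

(* Main.v *)
Require Import Defs.
From mathcomp Require Import all_boot.
From mathcomp Require Import order ssralg ssrnum ssrint intdiv.
From mathcomp Require Import zify ring.

(** Attach to every Markoff number [m] a numerator [u] with [u ^ 2 = -1] modulo
    [m], so that the slopes [u / m] are ordered in [[0, 1]] like the Farey
    fractions indexing the Markoff tree: each new slope lies strictly between
    its two neighbours. The slope of the maximal entry [c] therefore determines
    the position in the tree, hence the triple. If [c] is a prime power, [-1]
    has at most two square roots modulo [c], and they are exchanged by the
    reflection [(a, c, b) -> (b, c, a)]. *)

Set Implicit Arguments.
Unset Strict Implicit.

Import Order.TTheory GRing.Theory Num.Theory.
Local Open Scope ring_scope.

(** * Slopes and the tree of nodes *)

(** When both first entries are positive, its sign is that of the slope difference
    [y.2 / y.1 - x.2 / x.1]. *)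
Definition cross (x y : int * int) : int := x.1 * y.2 - y.1 * x.2.

Lemma cross_trans (x y z : int * int) :
  0 < x.1 -> 0 < y.1 -> 0 < z.1 ->
  0 < cross x y -> 0 < cross y z -> 0 < cross x z.
Proof.
rewrite /cross => x0 y0 z0 xy yz; rewrite -(pmulr_rgt0 _ y0).
have -> : y.1 * (x.1 * z.2 - z.1 * x.2) =
  z.1 * (x.1 * y.2 - y.1 * x.2) + x.1 * (y.1 * z.2 - z.1 * y.2) by ring.
by rewrite addr_gt0 // mulr_gt0.
Qed.

(* A node lists the pairs [(m, u)] by increasing slope; the middle one carries
   the largest Markoff number. *)
Record node := Node { left : int * int; mid : int * int; right : int * int }.

(* In terms of Cohn matrices [A], [AB], [B] these are [A], [A(AB)], [AB] and
   [AB], [(AB)B], [B], by [M ^ 2 = tr M * M - 1] and [tr M = 3 m]. *)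
Definition child (d : bool) (t : node) : node :=
  let: Node x y z := t in
  if d then Node y (3 * z.1 * y.1 - x.1, 3 * z.1 * y.2 - x.2) z
  else Node x (3 * x.1 * y.1 - z.1, 3 * x.1 * y.2 - z.2) y.

Definition descend (t : node) (s : seq bool) : node :=
  foldl (fun t d => child d t) t s.

Definition markoff_root : node := Node (1, 0) (2, 1) (1, 1).

(** * The invariant of the tree *)

(** The cross relations play the role of the Farey determinants. The slope bounds keep the middle
    numerator strictly between 0 and the middle number; coprimality permits cancelling modulo that
    number. *)
Record coherent (t : node) : Prop := Coherent {
  left_gt0 : 0 < (left t).1;
  mid_gt0 : 0 < (mid t).1;
  right_gt0 : 0 < (right t).1;
  left_slope_ge0 : 0 <= (left t).2;
  right_slope_le1 : (right t).2 <= (right t).1;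
  cross_left_mid : cross (left t) (mid t) = (right t).1;
  cross_mid_right : cross (mid t) (right t) = (left t).1;
  coherent_markoff : (left t).1 ^+ 2 + (mid t).1 ^+ 2 + (right t).1 ^+ 2 =
    3 * (left t).1 * (mid t).1 * (right t).1;
  coprime_left_mid : coprimez (left t).1 (mid t).1;
  coprime_right_mid : coprimez (right t).1 (mid t).1;
  coprime_left_right : coprimez (left t).1 (right t).1 }.

Lemma coherent_root : coherent markoff_root.
Proof. by []. Qed.

Lemma coprimezMBr (k m n : int) : coprimez m (k * m - n) = coprimez m n.
Proof. by rewrite /coprimez gcdzMDl gcdzN. Qed.

(** The linear relation between three plane vectors gives [c * cross = a ^ 2 + b ^ 2], and the
    Markoff equation makes this [c * (3 * a * b - c)]. *)
Lemma cross_left_right (t : node) : coherent t ->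
  cross (left t) (right t) =
    3 * (left t).1 * (right t).1 - (mid t).1.
Proof.
case: t => [[a ua] [c uc] [b ub]] [/= a0 c0 b0 _ _ ac cb abc _ _ _].
apply: (mulfI (lt0r_neq0 c0)).
have -> : c * cross (a, ua) (b, ub) =
  a * cross (c, uc) (b, ub) + b * cross (a, ua) (c, uc) by rewrite /cross /=; ring.
by rewrite ac cb; nia.
Qed.

Lemma mid_slope_gt0 (t : node) : coherent t -> 0 < (mid t).2.
Proof.
case: t => [[a ua] [c uc] [b ub]] [/= a0 c0 b0 ua0 _].
rewrite {1}/cross /= => ac _ _ _ _ _.
rewrite -(pmulr_rgt0 _ a0); have -> : a * uc = b + c * ua by nia.
by rewrite ltr_wpDr // mulr_ge0 // ltW.
Qed.

Lemma mid_slope_lt1 (t : node) : coherent t -> (mid t).2 < (mid t).1.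
Proof.
case: t => [[a ua] [c uc] [b ub]] [/= a0 c0 b0 _ ub1 _].
rewrite /cross /= => cb _ _ _ _.
rewrite -(ltr_pM2l b0); have -> : b * uc = c * ub - a by nia.
by rewrite ltrBlDr ltr_pwDr // mulrC ler_wpM2r // ltW.
Qed.

Lemma coherent_child (d : bool) (t : node) : coherent t -> coherent (child d t).
Proof.
move=> t_coh; move: (cross_left_right t_coh) (mid_slope_gt0 t_coh).
move: (mid_slope_lt1 t_coh).
case: t t_coh => [[a ua] [c uc] [b ub]].
case; rewrite /cross /= => a0 c0 b0 ua0 ub1 ac cb abc cop_ac cop_bc cop_ab.
move=> uc1 uc0 ab.
case: d; split; rewrite /cross //=; try by rewrite ltW.
(* By Vieta, the old entry [a] and the new one are the two roots of a quadratic with constant term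
   [b ^ 2 + c ^ 2]. *)
- rewrite -(pmulr_rgt0 _ a0).
  have -> : a * (3 * b * c - a) = b ^+ 2 + c ^+ 2 by nia.
  by rewrite addr_gt0 // exprn_gt0.
- by nia.
- by nia.
- by nia.
- by rewrite coprimezMBr coprimez_sym.
- by rewrite mulrAC coprimezMBr coprimez_sym.
- by rewrite coprimez_sym.
- rewrite -(pmulr_rgt0 _ b0).
  have -> : b * (3 * a * c - b) = a ^+ 2 + c ^+ 2 by nia.
  by rewrite addr_gt0 // exprn_gt0.
- by nia.
- by nia.
- by nia.
- by rewrite mulrAC coprimezMBr.
- by rewrite coprimezMBr coprimez_sym.
Qed.

Lemma coherent_descend (s : seq bool) (t : node) :
  coherent t -> coherent (descend t s).
Proof.
by elim: s t => //= d s IHs t t_coh; apply/IHs/coherent_child.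
Qed.

(** * Separation of slopes *)

Lemma cross_left_mid_gt0 (t : node) :
  coherent t -> 0 < cross (left t) (mid t).
Proof. by move=> t_coh; rewrite cross_left_mid ?right_gt0. Qed.

Lemma cross_mid_right_gt0 (t : node) :
  coherent t -> 0 < cross (mid t) (right t).
Proof. by move=> t_coh; rewrite cross_mid_right ?left_gt0. Qed.

(** The slope intervals are nested: a child keeps one end and moves the other to the middle
    slope. *)
Lemma descend_between (s : seq bool) (t : node) : coherent t ->
  0 < cross (left t) (mid (descend t s)) /\
  0 < cross (mid (descend t s)) (right t).
Proof.
elim: s t => [|d s IHs] t t_coh.
  by split; [apply: cross_left_mid_gt0 | apply: cross_mid_right_gt0].
have d_coh := coherent_child d t_coh.
have [lm mr] := IHs _ d_coh; rewrite -[descend _ _]/(descend t (d :: s)) in lm mr.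
have m0 := mid_gt0 (coherent_descend (d :: s) t_coh).
have l0 := left_gt0 t_coh; have c0 := mid_gt0 t_coh; have r0 := right_gt0 t_coh.
have lc := cross_left_mid_gt0 t_coh; have cr := cross_mid_right_gt0 t_coh.
move: (mid (descend t (d :: s))) lm mr m0 => m.
case: t {IHs t_coh d_coh} l0 c0 r0 lc cr => x y z /= x0 y0 z0 xy yz.
case: d => /= lm mr m0; split=> //.
- exact: (cross_trans x0 y0).
- exact: (cross_trans m0 y0).
Qed.

Lemma descend_cons_cross (d : bool) (s : seq bool) (t : node) : coherent t ->
  if d then 0 < cross (mid t) (mid (descend t (d :: s)))
  else 0 < cross (mid (descend t (d :: s))) (mid t).
Proof.
move=> /(coherent_child d)/(descend_between s)[].
by case: t => x y z; case: d.
Qed.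

Lemma crossC (x y : int * int) : cross x y = - cross y x.
Proof. by rewrite /cross; ring. Qed.

(** At the last common node of two distinct paths, the middle slope separates the two final slopes,
    or equals one of them and differs from the other. *)
Lemma slope_inj (s s' : seq bool) (t : node) : coherent t ->
  cross (mid (descend t s)) (mid (descend t s')) = 0 -> s = s'.
Proof.
elim: s s' t => [|d s IHs] [|d' s'] t t_coh // st0.
- have t0 : cross (mid t) (mid (descend t (d' :: s'))) = 0 by [].
  by have := descend_cons_cross d' s' t_coh; case: d' t0 {st0} => e; rewrite ?e // crossC e.
- have t0 : cross (mid (descend t (d :: s))) (mid t) = 0 by [].
  by have := descend_cons_cross d s t_coh; case: d t0 {st0} => e; rewrite ?e // crossC e.
- have [dd'|d'd] := eqVneq d d'.
    by move: st0; rewrite dd' => /(IHs _ _ (coherent_child d' t_coh))->.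
  have ds := descend_cons_cross d s t_coh.
  have ds' := descend_cons_cross d' s' t_coh.
  have := mid_gt0 t_coh; move: (mid_gt0 (coherent_descend (d :: s) t_coh)).
  move: (mid_gt0 (coherent_descend (d' :: s') t_coh)).
  case: d d' d'd ds ds' st0 => [] [] // _ ds ds' st0 m0' m0 c0.
    by have := cross_trans m0' c0 m0 ds' ds; rewrite crossC st0.
  by have := cross_trans m0 c0 m0' ds ds'; rewrite st0.
Qed.

(** * Descent to the root *)

(** Vieta descent: [3 * a * b - c] is the other root of the equation in [c], positive because the
    product of the roots is [a ^ 2 + b ^ 2]. *)
Lemma markoff_parent (a b c : int) : 0 < a -> a <= b -> b <= c -> 1 < c ->
  a ^+ 2 + b ^+ 2 + c ^+ 2 = 3 * a * b * c ->
  [/\ a = 1, b = 1 & c = 2] \/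
  [/\ 0 < 3 * a * b - c, 3 * a * b - c <= b, 1 < b & b < c].
Proof.
move=> a0 ab bc c1 abc; have b0 : 0 < b by exact: lt_le_trans ab.
have [b1|b1] := leP b 1.
  have [ea eb] : a = 1 /\ b = 1 by lia.
  by subst a b; left; split=> //; nia.
right; have c'0 : 0 < 3 * a * b - c by rewrite -(pmulr_rgt0 _ (lt_trans ltr01 c1)); nia.
(* [b] lies between the two roots of [x ^ 2 - 3 a b x + a ^ 2 + b ^ 2]. *)
have bcc' : (c - b) * (b - (3 * a * b - c)) = (3 * a - 2) * b ^+ 2 - a ^+ 2 by nia.
have ab2 : a ^+ 2 < (3 * a - 2) * b ^+ 2 by nia.
have : 0 < (c - b) * (b - (3 * a * b - c)) by rewrite bcc' subr_gt0.
have [->|] := eqVneq b c; first by rewrite subrr mul0r ltxx.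
move=> bc'; have {}bc : b < c by rewrite lt_neqAle bc'.
by rewrite pmulr_rgt0 ?(subr_gt0 b) // => c'b; split=> //; lia.
Qed.

Definition reachable (t : node) : Prop :=
  exists s, t = descend markoff_root s.

Lemma reachable_root : reachable markoff_root.
Proof. by exists [::]. Qed.

Lemma reachable_child (d : bool) (t : node) :
  reachable t -> reachable (child d t).
Proof. by move=> [s ->]; exists (rcons s d); rewrite /descend foldl_rcons. Qed.

Lemma reachable_coherent (t : node) : reachable t -> coherent t.
Proof. by move=> [s ->]; apply/coherent_descend/coherent_root. Qed.

Lemma reachable_mid_inj (t t' : node) :
  reachable t -> reachable t' -> mid t = mid t' -> t = t'.
Proof.
move=> [s ->] [s' ->] e; congr descend; apply: (slope_inj coherent_root).
by rewrite e /cross subrr.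
Qed.

(** Strong induction on [c]. The parent has the larger of [a] and [b] in the middle and the smaller
    on its own side, so both orders of a triple occur in the tree. *)
Lemma reachable_surj (a b c : int) :
  0 < a -> 0 < b -> a <= c -> b <= c -> 1 < c ->
  a ^+ 2 + b ^+ 2 + c ^+ 2 = 3 * a * b * c ->
  exists2 t, reachable t &
    [/\ (left t).1 = a, (mid t).1 = c & (right t).1 = b].
Proof.
have [n] := ubnP `|c|%N; elim: n a b c => // n IHn a b c cn a0 b0 ac bc c1 abc.
have [ab|/ltW ba] := leP a b.
- have [[-> -> ->]|[c'0 c'b b1 b_lt_c]] := markoff_parent a0 ab bc c1 abc.
    by exists markoff_root; first exact: reachable_root.
  have [|||||||t rt] := IHn a (3 * a * b - c) b; try lia.
  case: t rt => x y z /(reachable_child false) rt /= [xa yb zc].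
  by exists (child false (Node x y z)) => //=; split=> //; lia.
- have bac : b ^+ 2 + a ^+ 2 + c ^+ 2 = 3 * b * a * c by lia.
  have [[-> -> ->]|[c'0 c'a a1 a_lt_c]] := markoff_parent b0 ba ac c1 bac.
    by exists markoff_root; first exact: reachable_root.
  have [|||||||t rt] := IHn (3 * b * a - c) b a; try lia.
  case: t rt => x y z /(reachable_child true) rt /= [xc ya zb].
  by exists (child true (Node x y z)) => //=; split=> //; lia.
Qed.

(** * Numerators as square roots of -1 *)

(** Modulo [c], [a * uc = b] and [a ^ 2 + b ^ 2 = 0], with [a] invertible. *)
Lemma dvdz_mid_slope (t : node) : coherent t ->
  ((mid t).1 %| (mid t).2 ^+ 2 + 1)%Z.
Proof.
case: t => [[a ua] [c uc] [b ub]] [/= _ c0 _ _ _].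
rewrite /cross /= => ac _ abc cop_ac _ _.
have cop : coprimez c (a ^+ 2) by rewrite coprimez_sym coprimezXl.
rewrite -(Gauss_dvdzr _ cop).
apply/dvdzP; exists (3 * a * b - c + 2 * b * ua + c * ua ^+ 2).
have -> : a ^+ 2 * (uc ^+ 2 + 1) = (a * uc) ^+ 2 + a ^+ 2 by ring.
have -> : a * uc = b + c * ua by lia.
lia.
Qed.

(** Modulo [c], the cross relations read [b * uc = - a] in [t] and [b * vc = a] in [t'], with [b]
    invertible. *)
Lemma dvdz_mid_slope_reflect (t t' : node) : coherent t -> coherent t' ->
  (left t').1 = (right t).1 -> (mid t').1 = (mid t).1 ->
  (right t').1 = (left t).1 ->
  ((mid t).1 %| (mid t).2 + (mid t').2)%Z.
Proof.
case: t => [[a ua] [c uc] [b ub]]; case: t' => [[b' vb] [c' vc] [a' va]].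
move=> [/= _ c0 _ _ _ _ cb _ _ cop_bc _] [/= _ _ _ _ _ bc _ _ _ _ _].
move: cb bc; rewrite /cross /= => cb bc eb ec ea; subst a' b' c'.
rewrite coprimez_sym in cop_bc; rewrite -(Gauss_dvdzr _ cop_bc).
apply/dvdzP; exists (ub + vb); lia.
Qed.

(** If [p] misses one factor of [(u - v) * (u + v)], then [c] divides the other. If [p] divides
    both, then [p = 2], and [c = 2] since -1 is not a square modulo 4. *)
Lemma sqrtN1_mod_prime_power (p n : nat) (u v : int) :
  prime p -> (0 < n)%N -> let c : int := (p ^ n)%N in
  0 < u < c -> 0 < v < c -> (c %| u ^+ 2 + 1)%Z -> (c %| v ^+ 2 + 1)%Z ->
  u = v \/ (c %| u + v)%Z.
Proof.
move=> p_pr n0 c /andP[u0 uc] /andP[v0 vc] cu cv.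
have pc : (p %| c)%Z by rewrite /c dvdzE /= dvdn_exp.
have cuv : (c %| (u - v) * (u + v))%Z.
  have -> : (u - v) * (u + v) = (u ^+ 2 + 1) - (v ^+ 2 + 1) by ring.
  by rewrite rpredB.
have cop x : ~~ (p %| x)%Z -> coprimez c x.
  by rewrite dvdzE -prime_coprime //= coprimezE /= => px; rewrite coprimeXl.
have [pm|/cop/Gauss_dvdzr e] := boolP (p %| u - v)%Z; last by right; rewrite -e.
have [pp|/cop/Gauss_dvdzl e] := boolP (p %| u + v)%Z; last first.
  left; move: cuv; rewrite e -eqz_mod_dvd !modz_small ?uc ?vc ?ltW //.
  by move/eqP.
have p2u : (p %| 2 * u)%Z.
  by have -> : 2 * u = (u - v) + (u + v) by [ring]; rewrite rpredD.
have pNu : ~~ (p %| u)%Z.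
  apply/negP => pu; have : (p %| u ^+ 2 + 1 - u * u)%Z.
    by rewrite rpredB ?(dvdz_trans pc cu) ?dvdz_mulr.
  by rewrite expr2 addrAC subrr add0r dvdzE dvdn1 /= => /eqP p1; rewrite p1 in p_pr.
left; have {p2u} p2 : p = 2%N.
  move: p2u; rewrite dvdzE abszM /= Euclid_dvdM //.
  rewrite (negPf pNu : (p %| `|u|)%N = false) orbF.
  by rewrite dvdn_prime2 // => /eqP.
subst p; case: n n0 @c pc uc vc cu cv cuv cop => [//|[|n]] _ c pc uc vc cu _ _ _.
  by rewrite /c /= in uc vc; lia.
have : (4 %| u ^+ 2 + 1)%Z.
  by apply: dvdz_trans cu; rewrite dvdzE /= (dvdn_exp2l 2 (_ : 2 <= _)%N).
move=> /dvdzP[k uk]; case/negP: pNu; apply/dvdz_mod0P.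
have := divz_eq u 2; have := modz_ge0 u (isT : 2 != 0 :> int).
have := ltz_pmod u (isT : 0 < 2 :> int).
move: (u %/ 2)%Z (u %% 2)%Z => q r r2 r0 uqr.
(* For [u = 2 * q + 1], [u ^ 2 + 1] is 2 modulo 4. *)
have [//|r1] : r = 0 \/ r = 1 by lia.
by move: uk; rewrite uqr r1; have := mulrC q q; lia.
Qed.

(** * Uniqueness for prime powers *)

Lemma markoff_triple_reachable (a b c : nat) :
  markoff_triple a b c -> (a <= c)%N -> (b <= c)%N -> (1 < c)%N ->
  exists2 t, reachable t &
    [/\ (left t).1 = a, (mid t).1 = c & (right t).1 = b].
Proof. by move=> [a0 b0 _ abc] ac bc c1; apply: reachable_surj => //; lia. Qed.

Lemma markoff_prime_power_unique (p n c a b a' b' : nat) :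
  prime p -> (0 < n)%N -> c = (p ^ n)%N ->
  markoff_triple a b c -> markoff_triple a' b' c ->
  (a <= c)%N -> (b <= c)%N -> (a' <= c)%N -> (b' <= c)%N ->
  (a = a' /\ b = b') \/ (a = b' /\ b = a').
Proof.
move=> p_pr n0 cpn abc a'b'c ac bc a'c b'c.
have c1 : (1 < c)%N by rewrite cpn -(exp1n n) ltn_exp2r ?prime_gt1.
have b'a'c : markoff_triple b' a' c by case: a'b'c => *; split=> //; lia.
have [t rt [ta tc tb]] := markoff_triple_reachable abc ac bc c1.
have [t' rt' [t'a t'c t'b]] := markoff_triple_reachable a'b'c a'c b'c c1.
(* [r] is the mirror image of [t'], whose numerator is opposite to that of [t'] modulo [c]. *)
have [r rr [ra rc rb]] := markoff_triple_reachable b'a'c b'c a'c c1.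
have slope_lt x : reachable x -> (mid x).1 = c -> 0 < (mid x).2 < (c : int).
  by move=> /reachable_coherent x_coh <-; rewrite mid_slope_gt0 ?mid_slope_lt1.
have slope_dvd x : reachable x -> (mid x).1 = c -> (c %| (mid x).2 ^+ 2 + 1)%Z.
  by move=> /reachable_coherent x_coh <-; apply: dvdz_mid_slope.
have slope_eq x y : reachable x -> reachable y -> (mid x).1 = c ->
    (mid y).1 = c -> (mid x).2 = (mid y).2 -> x = y.
  move=> rx ry xc yc xy; apply: reachable_mid_inj => //.
  by rewrite [LHS]surjective_pairing xc xy -yc -surjective_pairing.
have [tt'|tt'] : (mid t).2 = (mid t').2 \/ (c %| (mid t).2 + (mid t').2)%Z.
  rewrite cpn; apply: sqrtN1_mod_prime_power; rewrite // -?cpn.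
  - exact: slope_lt.
  - exact: slope_lt.
  - exact: slope_dvd.
  - exact: slope_dvd.
- by left; move: ta tb; rewrite (slope_eq t t') // t'a t'b; lia.
(* The numerators of [t] and [r] are both opposite to that of [t'] modulo [c] and lie between 0 and
   [c], so they coincide. *)
- right; have : t = r; last by move=> tr; move: ta tb; rewrite tr ra rb; lia.
  apply: slope_eq => //; apply/eqP.
  have t'r : (c %| (mid t').2 + (mid r).2)%Z.
    have := dvdz_mid_slope_reflect (reachable_coherent rt') (reachable_coherent rr).
    by rewrite t'a t'b t'c ra rb rc; apply.
  have : (c %| (mid t).2 - (mid r).2)%Z.
    by have := rpredB tt' t'r; rewrite opprD addrA addrK.
  have /andP[/ltW t0 tlt] := slope_lt t rt tc.
  have /andP[/ltW r0 rlt] := slope_lt r rr rc.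
  by rewrite -eqz_mod_dvd !modz_small ?t0 ?r0.
Qed.

Local Close Scope ring_scope.

Theorem theorem1p1 (p n c : nat) (p_prime : prime p) (n_ge1 : 1 <= n)
    (c_pp : c = p ^ n) (a b a' b' : nat)
    (abc : markoff_triple a b c) (a'b'c : markoff_triple a' b' c)
    (ab_le : a <= b <= c) (a'b'_le : a' <= b' <= c) :
  a = a' /\ b = b'.
Proof.
have /andP[ab bc] := ab_le; have /andP[a'b' b'c] := a'b'_le.
have ac := leq_trans ab bc; have a'c := leq_trans a'b' b'c.
have := markoff_prime_power_unique p_prime n_ge1 c_pp abc a'b'c ac bc a'c b'c.
(* In the swapped case, [a <= b = a' <= b' = a] forces equality throughout. *)
by lia.
Qed.
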